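(* Let $p$ be a prime and $d\ge 1$ an integer. There is a one-to-one correspondence between the equivalence classes of norms on $\mathbb{Q}_p^d$ of the form $N^{A}_{q_1,\dots,q_d}$ with $A\in \mathrm{GL}_d(\mathbb{Q}_p)$ and $p^{-1}<q_1<\dots<q_d\le 1$, and the maximal simplices of the affine Bruhat--Tits building of $\mathbb{Q}_p^d$. Explicitly, it is given by sending the class of $N^{A}_{q_1,\dots,q_d}$ to the simplex whose vertices are the equivalence classes of the lattices $$L_j=\bigoplus_{i=1}^{j}\mathbb{Z}_pf_i\oplus\bigoplus_{i=j+1}^{d}p\mathbb{Z}_pf_i,\qquad j=1,\dots,d,$$ where $\{f_1,\dots,f_d\}$ is the basis of $\mathbb{Q}_p^d$ which $A$ maps to the coordinate basis, i.e. $Af_i=e_i$ for the standard basis $e_1,\dots,e_d$; this assignment is well defined and bijective.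
   Context: For $q_1,\dots,q_d>0$ and $A\in \mathrm{GL}_d(\mathbb{Q}_p)$, $N^{A}_{q_1,\dots,q_d}(z)=N_{q_1,\dots,q_d}(Az)$, where $N_{q_1,\dots,q_d}(z)=\max_{i=1,\dots,d}(q_i|z_i|_p)$ for $z\in\mathbb{Q}_p^d$. For a norm $N$, an $N$-ball is a set $\{y\in\mathbb{Q}_p^d: N(y-x)\le r\}$ with $x\in\mathbb{Q}_p^d$, $r>0$. Two norms are equivalent if they generate the same family of balls (as a family of subsets of $\mathbb{Q}_p^d$). A lattice in $\mathbb{Q}_p^d$ is an open compact $\mathbb{Z}_p$-submodule. Two lattices are equivalent if one is a scalar multiple of the other (by a nonzero element of $\mathbb{Q}_p$). The affine Bruhat--Tits building of $\mathbb{Q}_p^d$ is the simplicial complex whose vertices are equivalence classes of lattices and whose $(k-1)$-simplices, $1\le k\le d$, are the sets of $k$ distinct vertices having representatives $L_1,\dots,L_k$ with $pL_k\subsetneq L_1\subsetneq L_2\subsetneq\dots\subsetneq L_k$. A maximal simplex is one with $d$ vertices, i.e. a $(d-1)$-simplex. *)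

(* Defs.v *)
From HB Require Import structures.
From mathcomp Require Import all_boot all_order all_algebra.
From mathcomp Require Import all_classical all_reals topology.

Set Implicit Arguments.
Unset Strict Implicit.
Unset Printing Implicit Defensive.

Import Order.TTheory GRing.Theory Num.Theory.

Local Open Scope classical_set_scope.
Local Open Scope ring_scope.

(* Z_p is the inverse limit of the rings Z/p^n Z: a p-adic integer x is the
   sequence of its residues, [residue x n] being the representative in
   [0, p^n) of x modulo p^n (the range is forced by the coherence condition). *)
Record padic_int (p : nat) (p_pr : prime p) := PadicInt {
  residue :> nat -> nat;
  _ : `[< forall n, (residue n.+1 %% p ^ n)%N = residue n >] }.

HB.instance Definition _ p (p_pr : prime p) := [isSub for @residue p p_pr].
HB.instance Definition _ p (p_pr : prime p) :=
  [Choice of padic_int p_pr by <:].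

Section PadicInt.
Variables (p : nat) (p_pr : prime p).
Local Notation Zp := (padic_int p_pr).
Implicit Types x y z : Zp.

Let pX_gt0 n : (0 < p ^ n)%N. Proof. by rewrite expn_gt0 prime_gt0. Qed.

Lemma residueS x n : (x n.+1 %% p ^ n)%N = x n.
Proof. by case: x => f /= /asboolP. Qed.

Lemma residueP x y : (forall n, x n = y n) -> x = y.
Proof. by move=> xy; apply/val_inj/funext. Qed.

Lemma residue_mod x k n : (k <= n)%N -> (x n %% p ^ k)%N = x k.
Proof.
elim: n => [|n IHn].
  by rewrite leqn0 => /eqP->; rewrite -(residueS x 0) modn_mod.
rewrite leq_eqVlt => /predU1P[->|]; last first.
  rewrite ltnS => le_kn; rewrite -(IHn le_kn) -(residueS x n).
  by rewrite modn_dvdm // dvdn_exp2l.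
by rewrite -(residueS x n.+1) modn_mod.
Qed.

(* The p-adic integer obtained by reducing [f n] modulo p^n. *)
Lemma padic_of_subproof (f : nat -> nat) :
  (forall n, f n.+1 = f n %[mod p ^ n])%N ->
  `[< forall n, ((f n.+1 %% p ^ n.+1) %% p ^ n)%N = (f n %% p ^ n)%N >].
Proof.
by move=> Hf; apply/asboolP => n; rewrite modn_dvdm ?Hf // dvdn_exp2l.
Qed.
Definition padic_of f Hf : Zp := PadicInt p_pr (@padic_of_subproof f Hf).

Fact padic_cst_subproof (m n : nat) : (m = m %[mod p ^ n])%N.
Proof. by []. Qed.
Definition padic_cst m : Zp := padic_of (padic_cst_subproof m).

Fact padic_add_subproof x y n :
  (x n.+1 + y n.+1 = x n + y n %[mod p ^ n])%N.
Proof. by rewrite -modnDm !residueS. Qed.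
Definition padic_add x y : Zp := padic_of (padic_add_subproof x y).

Fact padic_mul_subproof x y n :
  (x n.+1 * y n.+1 = x n * y n %[mod p ^ n])%N.
Proof. by rewrite -modnMm !residueS. Qed.
Definition padic_mul x y : Zp := padic_of (padic_mul_subproof x y).

(* [p ^ n - 1] represents -1 modulo p^n. *)
Fact padic_opp_subproof x n :
  ((p ^ n.+1).-1 * x n.+1 = (p ^ n).-1 * x n %[mod p ^ n])%N.
Proof.
apply/eqP; rewrite -(eqn_modDr (x n.+1)) -mulSnr prednK //.
rewrite -[X in _ == X]modnDmr residueS -mulSnr prednK //.
by rewrite expnS -mulnA mulnCA !modnMr.
Qed.
Definition padic_opp x : Zp := padic_of (padic_opp_subproof x).

Fact padic_addA : associative padic_add.
Proof.
by move=> x y z; apply: residueP => n; rewrite /= modnDml modnDmr addnA.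
Qed.

Fact padic_addC : commutative padic_add.
Proof. by move=> x y; apply: residueP => n; rewrite /= addnC. Qed.

Fact padic_add0 : left_id (padic_cst 0) padic_add.
Proof.
by move=> x; apply: residueP => n; rewrite /= mod0n add0n residue_mod.
Qed.

Fact padic_addN : left_inverse (padic_cst 0) padic_opp padic_add.
Proof.
move=> x; apply: residueP => n /=.
by rewrite modnDml -mulSnr prednK // modnMr mod0n.
Qed.

HB.instance Definition _ := GRing.isZmodule.Build Zp
  padic_addA padic_addC padic_add0 padic_addN.

Fact padic_mulA : associative padic_mul.
Proof.
by move=> x y z; apply: residueP => n; rewrite /= modnMml modnMmr mulnA.
Qed.

Fact padic_mulC : commutative padic_mul.
Proof. by move=> x y; apply: residueP => n; rewrite /= mulnC. Qed.

Fact padic_mul1 : left_id (padic_cst 1) padic_mul.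
Proof.
by move=> x; apply: residueP => n; rewrite /= modnMml mul1n residue_mod.
Qed.

Fact padic_mulD : left_distributive padic_mul padic_add.
Proof.
by move=> x y z; apply: residueP => n; rewrite /= modnMml modnDm mulnDl.
Qed.

Fact padic_one_neq0 : padic_cst 1 != 0.
Proof.
apply/eqP => /(congr1 (fun x : Zp => x 1%N)) /=.
by rewrite mod0n modn_small // expn1 prime_gt1.
Qed.

HB.instance Definition _ := GRing.Zmodule_isComNzRing.Build Zp
  padic_mulA padic_mulC padic_mul1 padic_mulD padic_one_neq0.

Lemma residue0 n : (0 : Zp) n = 0%N. Proof. exact: mod0n. Qed.

Lemma residueD x y n : (x + y) n = ((x n + y n) %% p ^ n)%N.
Proof. by []. Qed.

Lemma residueM x y n : (x * y) n = ((x n * y n) %% p ^ n)%N.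
Proof. by []. Qed.

Lemma residue_eq0 x k n : (k <= n)%N -> (x k == 0%N) = (p ^ k %| x n)%N.
Proof. by move=> le_kn; rewrite /dvdn residue_mod. Qed.

Definition padic_int_val x : nat :=
  xget 0%N [set n | x n = 0%N /\ x n.+1 <> 0%N].

Lemma residue_valP x : x != 0 ->
  x (padic_int_val x) = 0%N /\ x (padic_int_val x).+1 <> 0%N.
Proof.
move=> x_neq0; have [n xn0] : exists n, x n != 0%N.
  apply/not_existsP => x0; case/eqP: x_neq0; apply: residueP => n.
  by rewrite residue0; have /negP := x0 n; rewrite negbK => /eqP.
apply: (@xgetPex _ 0%N [set n | x n = 0%N /\ x n.+1 <> 0%N]).
elim: n xn0 => [|n IHn]; first by rewrite -(residueS x 0) modn1.
by have [xn0 /eqP|/IHn] := eqVneq (x n) 0%N; first by exists n.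
Qed.

Lemma residue_val x k : x != 0 -> (x k == 0%N) = (k <= padic_int_val x)%N.
Proof.
move=> /residue_valP[xv0 xSv]; have [le_kv|lt_vk] := leqP.
  by rewrite -(residue_mod x le_kv) xv0 mod0n.
by apply/eqP => xk0; case: xSv; rewrite -(residue_mod x lt_vk) xk0 mod0n.
Qed.

Let mul_neq0_val x y : x != 0 -> y != 0 ->
  x * y != 0 /\
  padic_int_val (x * y) = (padic_int_val x + padic_int_val y)%N.
Proof.
move=> x0 y0; pose a := padic_int_val x; pose b := padic_int_val y.
have logE z m : z != 0 -> (padic_int_val z < m)%N ->
    (0 < z m)%N /\ logn p (z m) = padic_int_val z.
  move=> z0 lt_vm; have zm_gt0 : (0 < z m)%N.
    by rewrite lt0n residue_val // -ltnNge.
  split=> //; apply/eqP; rewrite eqn_leq -!(pfactor_dvdn _ p_pr zm_gt0).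
  rewrite leqNgt -(pfactor_dvdn _ p_pr zm_gt0).
  rewrite -!residue_eq0 ?(ltnW lt_vm) //.
  by rewrite !residue_val // ltnn leqnn.
have xyE k : (k <= (a + b).+1)%N -> ((x * y) k == 0%N) = (k <= a + b)%N.
  move=> le_k; pose m := (a + b).+1.
  have [|xm_gt0 lx] := @logE x m x0; first by rewrite ltnS leq_addr.
  have [|ym_gt0 ly] := @logE y m y0; first by rewrite ltnS leq_addl.
  rewrite (residue_eq0 _ le_k) residueM /dvdn modn_dvdm ?dvdn_exp2l //.
  by rewrite [LHS](pfactor_dvdn _ p_pr) ?muln_gt0 ?xm_gt0 // lognM // lx ly.
have xy0 : x * y != 0.
  apply/eqP => xy0; have := xyE (a + b).+1 (leqnn _).
  by rewrite xy0 residue0 ltnn.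
split=> //; apply/eqP; rewrite eqn_leq -residue_val // xyE // leqnn andbT.
by rewrite leqNgt -residue_val // xyE // ltnn.
Qed.

Fact padic_int_integral x y : x * y = 0 -> (x == 0) || (y == 0).
Proof.
move=> xy0; apply/norP => -[x0 y0].
by have [/eqP] := mul_neq0_val x0 y0.
Qed.

Definition padic_int_unit : pred Zp := fun x => `[< exists y, y * x = 1 >].
Definition padic_int_inv x : Zp :=
  if padic_int_unit x then xget 0 [set y | y * x = 1] else x.

Fact padic_int_mulV : {in padic_int_unit, left_inverse 1 padic_int_inv *%R}.
Proof.
move=> x xU; rewrite /padic_int_inv ifT //; have /asboolP[y yx1] := xU.
by apply: (@xgetPex _ 0 [set y | y * x = 1]); exists y.
Qed.

Fact padic_int_unitPl x y : y * x = 1 -> padic_int_unit x.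
Proof. by move=> yx1; apply/asboolP; exists y. Qed.

Fact padic_int_inv_out : {in [predC padic_int_unit], padic_int_inv =1 id}.
Proof. by move=> x /negPf xU; rewrite /padic_int_inv ifF. Qed.

HB.instance Definition _ := GRing.ComNzRing_hasMulInverse.Build Zp
  padic_int_mulV padic_int_unitPl padic_int_inv_out.

HB.instance Definition _ :=
  GRing.ComUnitRing_isIntegral.Build Zp padic_int_integral.

Definition padic_int_abs x : rat :=
  if x == 0 then 0 else p%:R ^- padic_int_val x.

Let p_gt1 : 1 < p%:R :> rat. Proof. by rewrite ltr1n prime_gt1. Qed.
Let p_gt0 : 0 < p%:R :> rat. Proof. exact: lt_trans p_gt1. Qed.

Lemma padic_int_abs_ge0 x : 0 <= padic_int_abs x.
Proof. by rewrite /padic_int_abs; case: ifP; rewrite // invr_ge0 exprn_ge0 ?ltW. Qed.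

Lemma padic_int_abs_eq0 x : (padic_int_abs x == 0) = (x == 0).
Proof.
rewrite /padic_int_abs; case: ifP; rewrite ?eqxx // => _.
by rewrite invr_eq0 expf_eq0 (gt_eqF p_gt0) andbF.
Qed.

Lemma padic_int_absM x y :
  padic_int_abs (x * y) = padic_int_abs x * padic_int_abs y.
Proof.
rewrite /padic_int_abs; have [->|x0] := eqVneq x 0; first by rewrite mul0r eqxx mul0r.
have [->|y0] := eqVneq y 0; first by rewrite mulr0 eqxx mulr0.
have [/negPf-> ->] := mul_neq0_val x0 y0.
by rewrite exprD invfM.
Qed.

Lemma padic_int_abs1 : padic_int_abs 1 = 1.
Proof.
have /eqP := padic_int_absM 1 1; rewrite mulr1 -[X in X == _]mulr1 => /eqP.
by move/mulfI => <- //; rewrite padic_int_abs_eq0 oner_eq0.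
Qed.

Lemma padic_int_abs_le x k : (padic_int_abs x <= p%:R ^- k) = (x k == 0%N).
Proof.
rewrite /padic_int_abs; have [->|x0] := eqVneq x 0.
  by rewrite residue0 eqxx invr_ge0 exprn_ge0 // ltW.
by rewrite residue_val // lef_pV2 ?posrE ?exprn_gt0 // ler_eXn2l.
Qed.

Lemma padic_int_absN x : padic_int_abs (- x) = padic_int_abs x.
Proof.
rewrite -mulN1r padic_int_absM; have : padic_int_abs (-1) ^+ 2 = 1.
  by rewrite expr2 -padic_int_absM mulrNN mulr1 padic_int_abs1.
move/eqP; rewrite sqrp_eq1 ?padic_int_abs_ge0 // => /eqP->.
by rewrite mul1r.
Qed.

Lemma padic_int_absD x y :
  padic_int_abs (x + y) <= Num.max (padic_int_abs x) (padic_int_abs y).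
Proof.
wlog le_xy : x y / padic_int_abs x <= padic_int_abs y.
  have [le_xy|/ltW le_yx] := leP (padic_int_abs x) (padic_int_abs y).
    by move/(_ _ _ le_xy); rewrite (max_idPr le_xy).
  by move/(_ _ _ le_yx); rewrite addrC (max_idPr le_yx).
rewrite (max_idPr le_xy); have [y0|y0] := eqVneq y 0.
  have: padic_int_abs x <= 0 by rewrite (le_trans le_xy) // y0 /padic_int_abs eqxx.
  by rewrite y0 addr0 /padic_int_abs [X in _ -> _ <= X]ifT.
rewrite [padic_int_abs y]/padic_int_abs (negPf y0) in le_xy *.
rewrite padic_int_abs_le residueD; move: le_xy; rewrite padic_int_abs_le => /eqP->.
by rewrite add0n residue_mod // residue_val.
Qed.

End PadicInt.

(* Q_p is the fraction field of Z_p. *)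
Definition padic (p : nat) (p_pr : prime p) := {fraction (padic_int p_pr)}.

HB.instance Definition _ p (p_pr : prime p) := GRing.Field.on (padic p_pr).

Definition padic_of_int (p : nat) (p_pr : prime p) (x : padic_int p_pr) :
  padic p_pr := FracField.tofrac x.

(* The p-adic absolute value |n / d|_p = |n|_p / |d|_p, normalized so that
   |p|_p = 1 / p. It takes rational values. *)
Definition padic_abs (p : nat) (p_pr : prime p) (x : padic p_pr) : rat :=
  padic_int_abs \n_(repr x) / padic_int_abs \d_(repr x).

Section Padic.
Variables (p : nat) (p_pr : prime p).
Local Notation Zp := (padic_int p_pr).
Local Notation Qp := (padic p_pr).
Local Notation "x %:F" := (padic_of_int x).
Implicit Types x y z : Qp.

HB.instance Definition _ := GRing.RMorphism.copy
  (@padic_of_int p p_pr) (@FracField.tofrac Zp).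

Lemma padic_of_int_eq0 (a : Zp) : (a%:F == 0) = (a == 0).
Proof. exact: tofrac_eq0. Qed.

Lemma padic_of_intM : {morph @padic_of_int p p_pr : a b / a * b}.
Proof. exact: rmorphM. Qed.

Lemma padic_of_intD : {morph @padic_of_int p p_pr : a b / a + b}.
Proof. exact: rmorphD. Qed.

Lemma padic_reprE x : x = (\n_(repr x))%:F / (\d_(repr x))%:F.
Proof.
have d0 := denom_ratioP (repr x).
apply/(canRL (mulfK _)); first by rewrite padic_of_int_eq0.
rewrite /padic_of_int -{1}[x]reprK; unlock FracField.tofrac.
rewrite -[LHS]FracField.pi_mul /FracField.mulf !numden_Ratio ?oner_neq0 //.
rewrite mulr1; apply/eqmodP.
by rewrite /= FracField.equivfE !numden_Ratio ?oner_neq0 // mulr1 mulrC.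
Qed.

Lemma padic_absE (a b : Zp) : b != 0 ->
  padic_abs (a%:F / b%:F) = padic_int_abs a / padic_int_abs b.
Proof.
move=> b0; set x := _ / _; rewrite /padic_abs.
have d0 := denom_ratioP (repr x); have /eqP := padic_reprE x.
rewrite {1}/x eqr_div ?padic_of_int_eq0 // -!padic_of_intM tofrac_eq => /eqP xE.
by apply/eqP; rewrite eqr_div ?padic_int_abs_eq0 // -!padic_int_absM -xE.
Qed.

Lemma padic_abs_int (a : Zp) : padic_abs a%:F = padic_int_abs a.
Proof.
rewrite -[a%:F]divr1 -[1](rmorph1 (@padic_of_int p p_pr)).
by rewrite padic_absE ?oner_neq0 // padic_int_abs1 divr1.
Qed.

Lemma padic_abs_p : padic_abs (p%:R : Qp) = p%:R^-1.
Proof.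
have pE n : (p%:R : Zp) n = (p %% p ^ n)%N.
  suff E m : (m%:R : Zp) n = (m %% p ^ n)%N by rewrite E.
  elim: m => [|m IHm]; first by rewrite residue0 mod0n.
  by rewrite -addn1 natrD residueD IHm /= modnDm.
have p0 : (p%:R : Zp) != 0.
  apply/eqP => /(congr1 (fun x : Zp => x 2)); rewrite residue0 pE modn_small.
    by move=> p0; have := prime_gt0 p_pr; rewrite p0.
  by rewrite expnS expn1 ltn_Pmull ?prime_gt1 ?prime_gt0.
rewrite -(rmorph_nat (@padic_of_int p p_pr)) padic_abs_int /padic_int_abs.
rewrite (negPf p0); suff -> : padic_int_val (p%:R : Zp) = 1%N by rewrite expr1.
apply/eqP; rewrite eqn_leq -residue_val // pE expn1 modnn eqxx andbT.
rewrite leqNgt -residue_val // pE modn_small.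
  by rewrite -lt0n prime_gt0.
by rewrite expnS expn1 ltn_Pmull ?prime_gt1 ?prime_gt0.
Qed.

Lemma padic_abs_ge0 x : 0 <= padic_abs x.
Proof. by rewrite divr_ge0 // padic_int_abs_ge0. Qed.

Lemma padic_abs0 : padic_abs (0 : Qp) = 0.
Proof.
rewrite -(rmorph0 (@padic_of_int p p_pr)) padic_abs_int.
by rewrite /padic_int_abs eqxx.
Qed.

Lemma padic_abs_eq0 x : (padic_abs x == 0) = (x == 0).
Proof.
rewrite {2}[x]padic_reprE /padic_abs !mulf_eq0 !invr_eq0 !padic_int_abs_eq0.
by rewrite !padic_of_int_eq0.
Qed.

Lemma padic_absM x y : padic_abs (x * y) = padic_abs x * padic_abs y.
Proof.
have dx := denom_ratioP (repr x); have dy := denom_ratioP (repr y).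
rewrite {1}[x]padic_reprE {1}[y]padic_reprE mulf_div -!padic_of_intM.
by rewrite padic_absE ?mulf_neq0 // !padic_int_absM mulf_div.
Qed.

Lemma padic_absN x : padic_abs (- x) = padic_abs x.
Proof.
have dx := denom_ratioP (repr x).
by rewrite {1}[x]padic_reprE -mulNr -rmorphN padic_absE // padic_int_absN.
Qed.

Lemma padic_absD x y :
  padic_abs (x + y) <= Num.max (padic_abs x) (padic_abs y).
Proof.
have dx := denom_ratioP (repr x); have dy := denom_ratioP (repr y).
rewrite {1}[x]padic_reprE {1}[y]padic_reprE.
rewrite addf_div ?padic_of_int_eq0 // -!padic_of_intM -padic_of_intD.
rewrite padic_absE ?mulf_neq0 // ler_pdivrMr; last first.
  by rewrite lt_def padic_int_abs_eq0 mulf_neq0 ?padic_int_abs_ge0.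
rewrite maxr_pMl ?padic_int_abs_ge0 // (le_trans (padic_int_absD _ _)) //.
rewrite /padic_abs !padic_int_absM mulrA divfK ?padic_int_abs_eq0 //.
rewrite [padic_int_abs \d_(repr x) * padic_int_abs _]mulrC mulrA divfK //.
by rewrite padic_int_abs_eq0.
Qed.

Let padic_dist x y := padic_abs (x - y).

Fact padic_distxx x : padic_dist x x = 0.
Proof. by rewrite /padic_dist subrr padic_abs0. Qed.

Fact padic_dist_positivity x y : padic_dist x y = 0 -> x = y.
Proof. by move/eqP; rewrite padic_abs_eq0 subr_eq0 => /eqP. Qed.

Fact padic_dist_sym x y : padic_dist x y = padic_dist y x.
Proof. by rewrite /padic_dist -padic_absN opprB. Qed.

Fact padic_dist_triangle y x z :
  padic_dist x z <= padic_dist x y + padic_dist y z.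
Proof.
rewrite /padic_dist -[x - z](subrKA y); apply: le_trans (padic_absD _ _) _.
by rewrite ge_max lerDl lerDr !padic_abs_ge0.
Qed.

(* The topology of Q_p is that of the distance |x - y|_p; column vectors
   ['cV[padic p_pr]_d] then carry the product topology. *)
HB.instance Definition _ := isMetric.Build rat Qp
  padic_distxx padic_dist_positivity padic_dist_sym padic_dist_triangle.

End Padic.

Section Norms.
Variables (R : realType) (p : nat) (p_pr : prime p) (d : nat).
Local Notation Qp := (padic p_pr).
Local Notation V := 'cV[Qp]_d.

(* The entries being compared are nonnegative when the q i are positive, so
   the base value 0 does not affect the maximum. *)
Definition max_norm (q : 'I_d -> R) (z : V) : R :=
  \big[Num.max/0]_(i < d) (q i * ratr (padic_abs (z i 0))).

Definition matrix_max_norm (A : 'M[Qp]_d) (q : 'I_d -> R) (z : V) : R :=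
  max_norm q (A *m z).

Definition norm_balls (N : V -> R) : set (set V) :=
  [set B | exists x : V, exists2 r : R, 0 < r & B = [set y | N (y - x) <= r]].

Definition norm_equiv (N1 N2 : V -> R) : Prop := norm_balls N1 = norm_balls N2.

Definition chamber_weights (q : 'I_d -> R) : Prop :=
  (forall i, p%:R^-1 < q i <= 1) /\ (forall i j : 'I_d, (i < j)%N -> q i < q j).

Definition chamber_norms : set (V -> R) :=
  [set N | exists A q,
    [/\ A \in unitmx, chamber_weights q & N = matrix_max_norm A q]].

(* Classes are taken among the norms N^A_q with p^-1 < q_1 < ... < q_d <= 1. *)
Definition norm_class (N : V -> R) : set (V -> R) :=
  [set N' | chamber_norms N' /\ norm_equiv N N'].

Definition chamber_norm_classes : set (set (V -> R)) :=
  norm_class @` chamber_norms.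

End Norms.

Arguments chamber_norms R {p} p_pr d.
Arguments chamber_norm_classes R {p} p_pr d.

Section Building.
Variables (p : nat) (p_pr : prime p) (d : nat).
Local Notation Qp := (padic p_pr).
Local Notation V := 'cV[Qp]_d.

Definition is_lattice (L : set V) : Prop :=
  [/\ [/\ L 0, (forall u v, L u -> L v -> L (u + v))
        & forall (a : padic_int p_pr) v, L v -> L (padic_of_int a *: v)],
      open L & compact L].

Definition scale_set (c : Qp) (L : set V) : set V := [set c *: v | v in L].

Definition lattice_class (L : set V) : set (set V) :=
  [set L' | is_lattice L' /\ exists2 c : Qp, c != 0 & L' = scale_set c L].

(* [building_simplex k] is the set of (k-1)-simplices, with representing
   lattices L 0, ..., L k.-1. *)
Definition building_simplex (k : nat) : set (set (set (set V))) :=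
  [set S | (1 <= k <= d)%N /\ exists L : nat -> set V,
    [/\ (forall i, (i < k)%N -> is_lattice (L i)),
        scale_set p%:R (L k.-1) `<` L 0%N,
        (forall i, (i.+1 < k)%N -> L i `<` L i.+1),
        set_inj `I_k (lattice_class \o L)
      & S = (lattice_class \o L) @` `I_k]].

Definition maximal_simplices : set (set (set (set V))) := building_simplex d.

(* The sum over i <= j of Z_p f_i plus the sum over i > j of p Z_p f_i for
   1-based i; since i : 'I_d counts from 0, the condition i <= j is [i < j]. *)
Definition flag_lattice (f : 'I_d -> V) (j : nat) : set V :=
  [set v | exists c : 'I_d -> padic_int p_pr,
    v = \sum_(i < d)
          padic_of_int (if (i < j)%N then c i else p%:R * c i) *: f i].

Definition flag_simplex (f : 'I_d -> V) : set (set (set V)) :=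
  [set lattice_class (flag_lattice f j) | j in [set j | (1 <= j <= d)%N]].

End Building.

Arguments building_simplex {p} p_pr d k.
Arguments maximal_simplices {p} p_pr d.

(* Main.v *)
Require Import Defs.
From mathcomp Require Import all_boot all_order all_algebra cyclic.
From mathcomp Require Import all_classical all_reals topology.

Local Open Scope classical_set_scope.
Local Open Scope ring_scope.
Set Implicit Arguments.
Unset Strict Implicit.
Unset Printing Implicit Defensive.

Import Order.TTheory GRing.Theory Num.Theory.

(** Let [N] be the norm with matrix [A] and weights [q], and let [A] map [f i]
    to the [i]-th coordinate vector. Absolute values are powers of p and the
    weights satisfy 1/p < q_i <= 1 and increase with i, so that
    q_i |x| <= q_j |c| means |x| <= |c| if i <= j and |x| <= |p c| if i > j.
    Thus the ball of radius q_j |c| about 0 is c times the lattice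
    [flag_lattice f j.+1] ([central_ball_box]), and every ball about 0 is of
    this kind ([central_ball_normal_form]). Consequently the flag simplex of [f]
    is the set of classes of the balls about 0 ([ball_classes_flag]). As an
    ultrametric ball containing 0 is a ball about 0, this set is determined by
    the family of all balls, so the map is well defined on classes of norms. It
    is injective because the lattices in these classes are again balls about 0,
    and their translates are all the balls ([norm_balls_sub]).

    For surjectivity, choose in each L_j of a maximal simplex a vector f_j
    outside the previous lattice, p L_d being the one before L_1. Given a
    combination of the f_i, divide it by the last coefficient of maximal
    absolute value, say the k-th: the result is congruent to f_k modulo the
    lattice preceding L_k, hence not in it ([dominant_notin]). This both makes
    the f_i independent and bounds the coefficients of the elements of L_j as
    the flag lattices require ([chain_coordinates], [adapted_basis]).

    That flag lattices are open and compact comes down to Z_p being the closed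
    unit ball of Q_p ([padic_of_int_of_abs_le1]) and being compact
    ([padic_ultra_lim]). *)

(** * Divisibility of p-adic integers *)

Section PadicInt.
Context (p : nat) (p_pr : prime p).
Local Notation Zp := (padic_int p_pr).
Implicit Types (x y : Zp).

Lemma residue_nat k n : (k%:R : Zp) n = (k %% p ^ n)%N.
Proof.
elim: k => [|k IHk]; first by rewrite residue0 mod0n.
by rewrite -addn1 natrD residueD IHk /= modnDm.
Qed.

Lemma residue_sub_eq0 x y n : ((x - y) n == 0%N) = (x n == y n).
Proof.
have xE : x n = (((x - y)%R n + y n) %% p ^ n)%N by rewrite -residueD subrK.
have m0 (z : Zp) : (z n %% p ^ n)%N = z n by rewrite residue_mod.
apply/idP/idP => [/eqP xy0|/eqP xy]; first by rewrite xE xy0 add0n m0.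
move: xE; rewrite xy -{1}(m0 y) -{1}[y n]add0n => /esym/eqP.
by rewrite eqn_modDr m0 mod0n.
Qed.

(** The residues of the quotient are those of [x], shifted by [n] places and
    divided by [p ^ n]. *)
Lemma dvd_pX_of_residue0 x n : x n = 0%N -> exists y, x = p%:R ^+ n * y.
Proof.
move=> xn0; have pn0 : (0 < p ^ n)%N by rewrite expn_gt0 prime_gt0.
have dvd_x m : (p ^ n %| x (n + m))%N.
  by rewrite -residue_eq0 ?leq_addr // xn0.
have coh m : (x (n + m.+1) %/ p ^ n = x (n + m) %/ p ^ n %[mod p ^ m])%N.
  apply/eqP; rewrite -(eqn_pmul2l pn0) !muln_modr -expnD.
  rewrite ![(p ^ n * (_ %/ _))%N]mulnC !divnK //.
  by rewrite addnS residueS residue_mod.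
exists (padic_of p_pr coh); apply: residueP => m.
rewrite residueM -natrX residue_nat /= modnMml modnMmr mulnC divnK //.
by rewrite residue_mod ?leq_addl.
Qed.

(** Euler's theorem gives inverses of all the residues of [x]. *)
Lemma unit_of_residue1 x : x 1 <> 0%N -> exists y, x * y = 1.
Proof.
move=> x1; pose c m := (x m ^ (totient (p ^ m)).-1)%N.
have co m : coprime (x m) (p ^ m).
  case: m => [|m]; first by rewrite expn0 coprimen1.
  rewrite coprime_pexpr // coprime_sym prime_coprime //.
  by apply/negP; rewrite -[X in (X %| _)%N]expn1 -residue_eq0 // => /eqP.
have xc m : (x m * c m = 1 %[mod p ^ m])%N.
  rewrite -expnS prednK; first exact: Euler_exp_totient.
  by rewrite totient_gt0 expn_gt0 prime_gt0.
(* The residues are coherent since inverses modulo [p ^ m] are unique. *)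
have coh m : (c m.+1 = c m %[mod p ^ m])%N.
  have xc' : (x m * c m.+1 = 1 %[mod p ^ m])%N.
    rewrite -(residueS x m) modnMml -(@modn_dvdm (p ^ m.+1)) ?dvdn_exp2l //.
    by rewrite xc modn_dvdm ?dvdn_exp2l.
  rewrite -[c m.+1]mul1n -modnMml -(xc m) modnMml mulnAC.
  by rewrite -modnMml xc' modnMml mul1n.
exists (padic_of p_pr coh); apply: residueP => m.
by rewrite residueM (residue_nat 1) /= modnMmr xc.
Qed.

(** Divide both numbers by [p ^ n], with [n] the valuation of [y]: what is left
    of [y] is a unit. *)
Lemma dvd_of_abs_le x y :
  y != 0 -> padic_int_abs x <= padic_int_abs y -> exists z, x = y * z.
Proof.
move=> y0; have [yv yv1] := residue_valP y0.
rewrite [padic_int_abs y]/padic_int_abs (negPf y0) padic_int_abs_le => /eqP.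
move: (padic_int_val y) yv yv1 => n yn yn1 xn.
have [x' ->] := dvd_pX_of_residue0 xn; have [u yE] := dvd_pX_of_residue0 yn.
have [|w uw] := @unit_of_residue1 u.
  move=> u1; have [u' uE] : exists u', u = p%:R ^+ 1 * u'.
    exact: dvd_pX_of_residue0.
  apply: yn1; rewrite yE uE mulrA -exprD addn1 -natrX residueM residue_nat.
  by rewrite modnn mul0n mod0n.
by exists (w * x'); rewrite yE -mulrA [u * _]mulrA uw mul1r.
Qed.

End PadicInt.

(** * Absolute values and limits of p-adic numbers *)

Section Padic.
Context (p : nat) (p_pr : prime p).
Local Notation Zp := (padic_int p_pr).
Local Notation Qp := (padic p_pr).
Implicit Types (x y z : Qp).

Let p_gt1 : 1 < p%:R :> rat. Proof. by rewrite ltr1n prime_gt1. Qed.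
Let p_gt0 : 0 < p%:R :> rat. Proof. exact: lt_trans p_gt1. Qed.

Lemma padic_abs_gt0 x : (0 < padic_abs x) = (x != 0).
Proof. by rewrite lt_def padic_abs_eq0 padic_abs_ge0 andbT. Qed.

Lemma padic_abs1 : padic_abs (1 : Qp) = 1.
Proof.
by rewrite -(rmorph1 (@padic_of_int p p_pr)) padic_abs_int padic_int_abs1.
Qed.

Lemma padic_absV x : padic_abs x^-1 = (padic_abs x)^-1.
Proof.
have [->|x0] := eqVneq x 0; first by rewrite invr0 padic_abs0 invr0.
apply: (@mulfI _ (padic_abs x)); first by rewrite padic_abs_eq0.
by rewrite -padic_absM divff // padic_abs1 divff // padic_abs_eq0.
Qed.

Lemma padic_p_neq0 : (p%:R : Qp) != 0.
Proof. by rewrite -padic_abs_gt0 padic_abs_p invr_gt0. Qed.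

Lemma padic_abs_p_lt1 : padic_abs (p%:R : Qp) < 1.
Proof. by rewrite padic_abs_p invf_lt1. Qed.

Lemma padic_mulf_neq0 x y : x != 0 -> y != 0 -> x * y != 0.
Proof.
by move=> x0 y0; rewrite mulf_eq0; apply/norP; split; [exact: x0|exact: y0].
Qed.

Lemma padic_pX_neq0 n : (p%:R ^+ n : Qp) != 0.
Proof. by rewrite expf_eq0 negb_and orbC padic_p_neq0. Qed.

Lemma padic_abs_pX n : padic_abs (p%:R ^+ n : Qp) = p%:R ^- n.
Proof.
elim: n => [|n IHn]; first by rewrite padic_abs1 invr1.
by rewrite !exprS padic_absM IHn padic_abs_p invfM.
Qed.

Lemma padic_abs_of_int_le1 (a : Zp) : padic_abs (padic_of_int a) <= 1.
Proof.
rewrite padic_abs_int -[1](@invr1 rat) -(expr0 p%:R) padic_int_abs_le.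
by rewrite -(residueS a 0) modn1.
Qed.

Lemma padic_of_int_of_abs_le1 x :
  padic_abs x <= 1 -> exists a : Zp, x = padic_of_int a.
Proof.
have d0 := denom_ratioP (repr x).
rewrite {2}[x]padic_reprE /padic_abs ler_pdivrMr ?mul1r; last first.
  by rewrite lt_def padic_int_abs_eq0 d0 padic_int_abs_ge0.
move=> /(dvd_of_abs_le d0)[a ->]; exists a.
by rewrite padic_of_intM mulrAC mulfV ?mul1r // padic_of_int_eq0.
Qed.

Lemma padic_abs_pZ x : x != 0 -> exists k : int, padic_abs x = p%:R ^ k.
Proof.
move=> x0; have d0 := denom_ratioP (repr x).
have n0 : \n_(repr x) != 0.
  by apply: contraNneq x0 => n0; rewrite [x]padic_reprE n0 rmorph0 mul0r.
rewrite /padic_abs /padic_int_abs (negPf n0) (negPf d0) invrK.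
exists ((padic_int_val \d_(repr x))%:Z - (padic_int_val \n_(repr x))%:Z).
by rewrite expfzDr ?lt0r_neq0 // -exprnN mulrC -exprnP.
Qed.

(** Nonzero absolute values are integral powers of p, so two distinct ones
    differ at least by the factor p. *)
Lemma padic_abs_lt x y :
  padic_abs x < padic_abs y -> padic_abs x <= padic_abs (p%:R * y).
Proof.
have [->|x0] := eqVneq x 0; first by rewrite padic_abs0 padic_abs_ge0.
have [->|y0] := eqVneq y 0; first by rewrite padic_abs0 ltNge padic_abs_ge0.
rewrite padic_absM padic_abs_p.
have [k ->] := padic_abs_pZ x0; have [l ->] := padic_abs_pZ y0.
rewrite ltr_eXz2l // -{2}[p%:R]expr1z invr_expz -expfzDr ?lt0r_neq0 //.
by rewrite ler_eXz2l // addrC lerBrDr lezD1.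
Qed.

Lemma padic_abs_sum_lt (I : finType) (F : I -> Qp) (e : rat) :
  0 < e -> (forall i, padic_abs (F i) < e) -> padic_abs (\sum_i F i) < e.
Proof.
move=> e0 Fe; elim/big_ind: _ => [|x y xe ye|//]; first by rewrite padic_abs0.
by rewrite (le_lt_trans (padic_absD _ _)) // gt_max xe.
Qed.

(** The compactness of Z_p, along a map into it. As Z_p has finite quotients, an
    ultrafilter selects one residue modulo each power of p; these residues are
    coherent because any two members of the ultrafilter meet, and they define
    the limit. *)
Lemma padic_ultra_lim (T : Type) (F : set_system T) (g : T -> Qp) :
  UltraFilter F -> F [set t | padic_abs (g t) <= 1] ->
  exists2 x, padic_abs x <= 1 &
    forall n, F [set t | padic_abs (g t - x) <= p%:R ^- n].
Proof.
move=> FU Fg; have FP : ProperFilter F by exact: ultra_proper.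
pose B n k := [set t | padic_abs (g t - k%:R) <= p%:R ^- n].
have FB n : exists k, F (B n k).
  have cov : forall m, F [set t | exists2 k, (k < m)%N & B n k t] ->
      exists k, F (B n k).
    elim=> [F0|m IHm Fm].
      by case: (filter_not_empty F); apply: filterS F0 => t [].
    have [|FC] := in_ultra_setVsetC (B n m) FU; first by exists m.
    apply: IHm; apply: filterS (filterI Fm FC) => t [[k]].
    rewrite ltnS leq_eqVlt => /predU1P[->|lt_km] Bt nBt //.
    by exists k.
  apply: (cov (p ^ n)%N); apply: filterS Fg => t /= /padic_of_int_of_abs_le1[a].
  move=> ga; exists (a n).
    by rewrite -(residue_mod a (leqnn n)) ltn_mod expn_gt0 prime_gt0.
  rewrite /B /= ga -(rmorph_nat (@padic_of_int p p_pr)) -rmorphB padic_abs_int.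
  by rewrite padic_int_abs_le residue_sub_eq0 residue_nat residue_mod.
have [k Bk] := choice FB.
have coh n : (k n.+1 = k n %[mod p ^ n])%N.
  have [t [Bt1 Bt]] := filter_ex (filterI (Bk n.+1) (Bk n)).
  have : padic_abs ((k n.+1)%:R - (k n)%:R : Qp) <= p%:R ^- n.
    have -> : (k n.+1)%:R - (k n)%:R = (g t - (k n)%:R) - (g t - (k n.+1)%:R).
      by rewrite opprB [RHS]addrC subrKA.
    rewrite (le_trans (padic_absD _ _)) // ge_max Bt padic_absN.
    rewrite (le_trans Bt1) // lef_pV2 ?posrE ?exprn_gt0 //.
    by rewrite ler_eXn2l.
  rewrite -!(rmorph_nat (@padic_of_int p p_pr)) -rmorphB padic_abs_int.
  by rewrite padic_int_abs_le residue_sub_eq0 !residue_nat => /eqP.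
exists (padic_of_int (padic_of p_pr coh)); first exact: padic_abs_of_int_le1.
move=> n; apply: filterS (Bk n) => t Bt /=.
rewrite -[_ - _](subrKA (k n)%:R) (le_trans (padic_absD _ _)) // ge_max Bt /=.
rewrite -(rmorph_nat (@padic_of_int p p_pr)) -rmorphB padic_abs_int.
by rewrite padic_int_abs_le residue_sub_eq0 residue_nat.
Qed.

Lemma pX_lt_exists (e : rat) : 0 < e -> exists n, p%:R ^- n < e.
Proof.
move=> e0; exists (Num.truncn e^-1).+1; set n := _.+1.
rewrite invf_plt ?posrE ?exprn_gt0 //.
rewrite (lt_trans (truncnS_gt e^-1)) // -natrX ltr_nat.
exact: ltn_expl (prime_gt1 p_pr).
Qed.
End Padic.

(** * Lattices defined by coordinate bounds *)

Section Box.
Context (p : nat) (p_pr : prime p) (d : nat).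
Local Notation Qp := (padic p_pr).
Local Notation V := 'cV[Qp]_d.
Implicit Types (A B : 'M[Qp]_d) (s t : 'I_d -> Qp) (c x : Qp) (v w : V).

Lemma mulmx_continuous B : continuous (mulmx B : V -> V).
Proof.
move=> v P /nbhs_ballP[e /= e0 vP]; apply/nbhs_ballP.
pose M := 1 + \sum_ij padic_abs (B ij.1 ij.2).
have ge0 Q : 0 <= \sum_(ij | Q ij) padic_abs (B ij.1 ij.2).
  by apply: sumr_ge0 => ij _; exact: padic_abs_ge0.
have BM i j : padic_abs (B i j) < M.
  by rewrite /M (bigD1 (i, j)) //= addrCA ltrDl ltr_pwDl.
have M0 : 0 < M by rewrite ltr_pwDl.
exists (e / M) => /=; first exact: divr_gt0.
move=> w [_ vw]; apply: vP; split=> // i j; rewrite /ball /=.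
have -> : (B *m v) i j - (B *m w) i j = (B *m (v - w)) i j.
  by rewrite mulmxBr !mxE.
rewrite mxE; apply: padic_abs_sum_lt => // k.
rewrite padic_absM -(divfK (lt0r_neq0 M0) e) mulrC.
rewrite ltr_pM ?padic_abs_ge0 //; have := vw k j.
by rewrite /ball /= !mxE.
Qed.

(** If [A] maps the basis [f] to the coordinate basis, this is the sum of the
    modules s_i Z_p f_i, here described by inequalities so that it can be
    compared with balls of norms. *)
Definition box A s : set V :=
  [set v | forall i, padic_abs ((A *m v) i 0) <= padic_abs (s i)].

Lemma open_unit_box : open (box 1%:M (fun=> 1)).
Proof.
rewrite openE => v; rewrite /box /= => bv; apply/nbhs_ballP.
exists 1 => //= w [_ vw] i.
rewrite mul1mx -[w i 0](subrK (v i 0)) (le_trans (padic_absD _ _)) //.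
have := vw i 0; rewrite /ball /= -padic_absN opprB => /ltW vwi.
by have := bv i; rewrite mul1mx ge_max padic_abs1 vwi => ->.
Qed.

Lemma compact_unit_box : compact (box 1%:M (fun=> 1)).
Proof.
rewrite compact_ultra => F FU Fbox.
have FP : ProperFilter F by exact: ultra_proper.
have lim i : exists x, padic_abs x <= 1 /\
    forall n, F [set v : V | padic_abs (v i 0 - x) <= p%:R ^- n].
  have [|x x1 Fx] := @padic_ultra_lim _ p_pr _ F (fun v => v i 0) FU.
    by apply: filterS Fbox => v /(_ i); rewrite mul1mx padic_abs1.
  by exists x.
have [x Fx] := choice lim.
exists (\col_i x i); split.
  by move=> i /=; rewrite mul1mx mxE padic_abs1; case: (Fx i).
move=> P /nbhs_ballP[e /= e0 vP]; have [n ne] := pX_lt_exists p_pr e0.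
apply: filterS (vP) _.
have : F [set v : V | forall i, padic_abs (v i 0 - x i) <= p%:R ^- n].
  by apply: filter_forall => i; exact: (Fx i).2.
apply: filterS => v vx; split=> // i j; rewrite ord1 mxE /ball /=.
by rewrite -padic_absN opprB (le_lt_trans (vx i)).
Qed.

(** Rescaling the coordinates reduces any box to the unit box. *)
Lemma box_preimage A s v : (forall i, s i != 0) ->
  box A s v <-> box 1%:M (fun=> 1) (diag_mx (\row_i (s i)^-1) *m A *m v).
Proof.
move=> s0; split=> bv i; have := bv i.
  rewrite mul1mx -mulmxA mul_diag_mx !mxE padic_absM padic_absV padic_abs1.
  by rewrite ler_pdivrMl ?padic_abs_gt0 // mulr1.
rewrite mul1mx -mulmxA mul_diag_mx !mxE padic_absM padic_absV padic_abs1.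
by rewrite ler_pdivrMl ?padic_abs_gt0 // mulr1.
Qed.

(** The unit box is open and compact; pull openness back along an invertible
    matrix and push compactness forward along its inverse. *)
Lemma box_lattice A s :
  A \in unitmx -> (forall i, s i != 0) -> is_lattice (box A s).
Proof.
move=> Au s0; set B := diag_mx (\row_i (s i)^-1) *m A.
have Bu : B \in unitmx.
  rewrite unitmx_mul Au andbT unitmxE det_diag unitfE.
  by apply/prodf_neq0 => i _; rewrite mxE invr_eq0; exact: s0.
split; first split.
- by move=> i; rewrite mulmx0 mxE padic_abs0 padic_abs_ge0.
- move=> u v bu bv i; rewrite mulmxDr mxE (le_trans (padic_absD _ _)) //.
  by rewrite ge_max bu bv.
- move=> a v bv i; rewrite -scalemxAr mxE padic_absM.
  rewrite (le_trans _ (bv i)) // ler_piMl ?padic_abs_ge0 //.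
  exact: padic_abs_of_int_le1.
- have -> : box A s = mulmx B @^-1` box 1%:M (fun=> 1).
    by apply/seteqP; split=> v /(box_preimage _ _ s0).
  by apply: open_comp open_unit_box => v _; exact: mulmx_continuous.
- have -> : box A s = mulmx (invmx B) @` box 1%:M (fun=> 1).
    apply/seteqP; split=> [v /(box_preimage _ _ s0) bv|_ [v bv <-]].
      by exists (B *m v) => //; rewrite mulKmx.
    by apply/(box_preimage _ _ s0); rewrite -/B mulKVmx.
  apply: continuous_compact compact_unit_box.
  by apply: continuous_subspaceT; exact: mulmx_continuous.
Qed.

Lemma scale_box c A s :
  c != 0 -> scale_set c (box A s) = box A (fun i => c * s i).
Proof.
move=> c0; apply/seteqP; split=> [_ [v bv <-] i|v bv].
  by rewrite -scalemxAr mxE !padic_absM ler_pM2l ?padic_abs_gt0.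
exists (c^-1 *: v); last by rewrite scalerA divff // scale1r.
move=> i; rewrite -scalemxAr mxE padic_absM padic_absV.
by rewrite ler_pdivrMl ?padic_abs_gt0 // -padic_absM.
Qed.

Lemma box_subP A s t : A \in unitmx ->
  box A s `<=` box A t <-> forall i, padic_abs (s i) <= padic_abs (t i).
Proof.
move=> Au; split=> [st i|st v bv i]; last exact: le_trans (bv i) (st i).
have /(_ i) : box A t (invmx A *m (s i *: delta_mx i 0)).
  apply: st => k; rewrite mulKVmx // !mxE andbT.
  have [->|_] := eqVneq k i; first by rewrite mulr1.
  by rewrite mulr0 padic_abs0 padic_abs_ge0.
by rewrite mulKVmx // !mxE !eqxx mulr1.
Qed.

End Box.

(** * Flags of lattices *)

Section Flag.
Context (p : nat) (p_pr : prime p) (d : nat).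
Local Notation Qp := (padic p_pr).
Local Notation V := 'cV[Qp]_d.
Implicit Types (A : 'M[Qp]_d) (f : 'I_d -> V) (c : Qp) (L : set V).

Definition flag_scale (j : nat) (i : 'I_d) : Qp :=
  if (i < j)%N then 1 else p%:R.

Lemma flag_scale_neq0 j i : flag_scale j i != 0.
Proof. by rewrite /flag_scale; case: ifP; rewrite ?oner_neq0 ?padic_p_neq0. Qed.

Lemma padic_abs_p_le_flag j i :
  padic_abs (p%:R : Qp) <= padic_abs (flag_scale j i).
Proof.
rewrite /flag_scale; case: ifP => _ //.
by rewrite padic_abs1 ltW // padic_abs_p_lt1.
Qed.

Lemma mulmx_basis A f (c : 'I_d -> Qp) k :
  (forall i, A *m f i = delta_mx i 0) -> (A *m (\sum_i c i *: f i)) k 0 = c k.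
Proof.
move=> Af; rewrite mulmx_sumr summxE (bigD1 k) //= -scalemxAr Af !mxE !eqxx.
rewrite mulr1 big1 ?addr0 // => i ik.
by rewrite -scalemxAr Af !mxE eq_sym (negPf ik) mulr0.
Qed.

Lemma basis_expansion A f v : A \in unitmx ->
  (forall i, A *m f i = delta_mx i 0) -> v = \sum_i (A *m v) i 0 *: f i.
Proof.
move=> Au Af; apply: (can_inj (mulKmx Au)); apply/matrixP => i k.
by rewrite ord1 mulmx_basis.
Qed.

Lemma flag_lattice_box A f j : A \in unitmx ->
  (forall i, A *m f i = delta_mx i 0) ->
  flag_lattice f j = box A (flag_scale j).
Proof.
move=> Au Af; apply/seteqP; split=> [_ [c ->] i|v bv].
  rewrite mulmx_basis // /flag_scale; case: ifP => _.
    by rewrite padic_abs1 padic_abs_of_int_le1.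
  rewrite rmorphM rmorph_nat padic_absM ler_piMr ?padic_abs_ge0 //.
  exact: padic_abs_of_int_le1.
have vc i : exists a : padic_int p_pr,
    (A *m v) i 0 = flag_scale j i * padic_of_int a.
  have s0 := flag_scale_neq0 j i.
  pose x := (A *m v) i 0 / flag_scale j i.
  have [|a va] := @padic_of_int_of_abs_le1 _ p_pr x.
    by rewrite padic_absM padic_absV ler_pdivrMr ?padic_abs_gt0 // mul1r.
  by exists a; rewrite -va mulrC divfK.
have [c vE] := choice vc; exists c.
rewrite {1}(basis_expansion v Au Af); apply: eq_bigr => i _; rewrite vE.
by rewrite /flag_scale; case: ifP => _; rewrite ?mul1r // rmorphM rmorph_nat.
Qed.

Lemma scale_set_scale b c L : scale_set b (scale_set c L) = scale_set (b * c) L.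
Proof.
apply/seteqP; split=> [_ [_ [v Lv <-] <-]|_ [v Lv <-]].
  by exists v; rewrite ?scalerA.
by exists (c *: v); [exists v | rewrite scalerA].
Qed.

Lemma lattice_class_scale c L :
  c != 0 -> lattice_class (scale_set c L) = lattice_class L.
Proof.
move=> c0; apply/seteqP; split=> L' [L'L [b b0 L'E]]; split=> //.
  exists (b * c); first exact: (padic_mulf_neq0 b0 c0).
  by rewrite L'E scale_set_scale.
exists (b / c).
  by apply: (padic_mulf_neq0 b0); rewrite invr_eq0; exact: c0.
by rewrite L'E scale_set_scale (divfK c0).
Qed.

Lemma lattice_class_refl L : is_lattice L -> lattice_class L L.
Proof.
move=> latL; split=> //; exists 1; first exact: oner_neq0.
by apply/seteqP; split=> [v Lv|_ [v Lv <-]]; [exists v|]; rewrite ?scale1r.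
Qed.

(** Boxes are compared by comparing their scales coordinate by coordinate
    ([box_subP]); the scales of consecutive flag lattices differ in exactly one
    coordinate, and there by the factor p. *)
Lemma flag_simplex_maximal A f : (0 < d)%N -> A \in unitmx ->
  (forall i, A *m f i = delta_mx i 0) ->
  maximal_simplices p_pr d (flag_simplex f).
Proof.
move=> d_gt0 Au Af; split; first by rewrite d_gt0 leqnn.
have fE j := flag_lattice_box j Au Af.
have p_lt1 := padic_abs_p_lt1 p_pr.
exists (fun j => flag_lattice f j.+1); split.
- move=> j _; rewrite fE; apply: box_lattice Au _ => i.
  exact: flag_scale_neq0.
- rewrite !fE scale_box ?padic_p_neq0 //; split; rewrite box_subP //.
    move=> i; rewrite prednK // {1}/flag_scale ltn_ord mulr1.
    exact: padic_abs_p_le_flag.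
  move/(_ (Ordinal d_gt0)); rewrite /flag_scale /= mulr1.
  by rewrite padic_abs1 leNgt p_lt1.
- move=> j jd; rewrite !fE; split; rewrite box_subP //.
    move=> i; rewrite {1}/flag_scale.
    case: ifP => [ij|_]; last exact: padic_abs_p_le_flag.
    by rewrite /flag_scale ltnW.
  move/(_ (Ordinal jd)); rewrite /flag_scale /= ltnn ltnSn padic_abs1.
  by rewrite leNgt p_lt1.
- (* Comparing the coordinates [0] and [j] shows that no scalar maps one
     lattice of the flag onto another. *)
  move=> i j; rewrite !inE /=; wlog lt_ij : i j / (i < j)%N.
    move=> wlg id jd ij; have [lt_ij|lt_ji|//] := ltngtP i j; first exact: wlg.
    by apply/esym; apply: wlg.
  move=> id jd cls; exfalso.
  have /lattice_class_refl : is_lattice (flag_lattice f i.+1).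
    by rewrite fE; apply: box_lattice Au _ => k; exact: flag_scale_neq0.
  rewrite [lattice_class _]cls => -[_ [c c0]].
  rewrite !fE scale_box // => /seteqP[]; rewrite !box_subP //.
  move=> /(_ (Ordinal d_gt0)) c_ge1 /(_ (Ordinal jd)) c_lt1.
  move: c_ge1 c_lt1; rewrite /flag_scale /= ltnSn ltnS leqNgt lt_ij !mulr1.
  by rewrite padic_abs1 => c_ge1 /(le_trans c_ge1); rewrite leNgt p_lt1.
- apply/seteqP; split=> _ [j /= jd <-]; last by exists j.+1.
  by exists j.-1; rewrite /= prednK; case/andP: jd.
Qed.

End Flag.

(** * Bases adapted to a chain of lattices *)

Section AdaptedBasis.
Context (p : nat) (p_pr : prime p) (d : nat).
Local Notation Qp := (padic p_pr).
Local Notation V := 'cV[Qp]_d.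
Implicit Types (A : 'M[Qp]_d) (f : 'I_d -> V) (x : Qp).
Implicit Types (L : set V) (M : nat -> set V).

Definition is_submodule L : Prop :=
  [/\ L 0, (forall u v, L u -> L v -> L (u + v))
    & forall (a : padic_int p_pr) v, L v -> L (padic_of_int a *: v)].

Lemma submoduleZ L x v :
  is_submodule L -> padic_abs x <= 1 -> L v -> L (x *: v).
Proof. by move=> [_ _ LZ] /padic_of_int_of_abs_le1[a ->]; exact: LZ. Qed.

Lemma submodule_sum L (P : pred 'I_d) (v : 'I_d -> V) :
  is_submodule L -> (forall i, P i -> L (v i)) -> L (\sum_(i | P i) v i).
Proof. by move=> [L0 LD _] Lv; elim/big_ind: _. Qed.

Lemma submoduleB L u v : is_submodule L -> L (u + v) -> L v -> L u.
Proof.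
move=> Lsub Luv Lv; rewrite -(addrK v u).
case: (Lsub) => _ LD _; apply: LD => //.
by rewrite -scaleN1r; apply: submoduleZ; rewrite ?padic_absN ?padic_abs1.
Qed.

Lemma scale_submodule c L : is_submodule L -> is_submodule (scale_set c L).
Proof.
move=> [L0 LD LZ]; split.
- by exists 0; rewrite ?scaler0.
- move=> _ _ [u Lu <-] [v Lv <-].
  by exists (u + v); rewrite ?scalerDr //; exact: LD.
- move=> a _ [v Lv <-]; exists (padic_of_int a *: v); first exact: LZ.
  by rewrite !scalerA mulrC.
Qed.

Lemma scale_p_mem L x v : is_submodule L -> padic_abs x < 1 -> L v ->
  scale_set p%:R L (x *: v).
Proof.
move=> Lsub x1 Lv; have p0 := padic_p_neq0 p_pr.
exists (x / p%:R *: v); last by rewrite scalerA mulrC (divfK p0).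
apply: submoduleZ => //; rewrite padic_absM padic_absV ler_pdivrMr ?mul1r.
  by rewrite -[p%:R]mulr1; apply: padic_abs_lt; rewrite padic_abs1.
by rewrite padic_abs_gt0; exact: p0.
Qed.

(** Division by such a coordinate gives coefficients of the shape considered in
    [dominant_notin]. *)
Lemma last_dominant_coordinate (c : 'I_d -> Qp) i : c i != 0 ->
  exists k, [/\ c k != 0, forall l, padic_abs (c l) <= padic_abs (c k)
    & forall l : 'I_d, (k < l)%N -> padic_abs (c l) < padic_abs (c k)].
Proof.
move=> ci0; pose m := [arg max_(l > i) padic_abs (c l)]%O.
have mP l : padic_abs (c l) <= padic_abs (c m).
  by rewrite /m; case: arg_maxP => // k _; apply.
have [k /eqP km kP] : exists2 k, padic_abs (c k) == padic_abs (c m) &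
    forall l, padic_abs (c l) == padic_abs (c m) -> (l <= k)%N.
  pose P := [pred l | padic_abs (c l) == padic_abs (c m)].
  have Pm : P m by rewrite /=.
  by case: (arg_maxnP val Pm) => k Pk kP; exists k.
exists k; split; last first.
- move=> l kl; rewrite km lt_neqAle mP andbT; apply/negP => /kP.
  by rewrite leqNgt kl.
- by move=> l; rewrite km.
rewrite -padic_abs_gt0 km (lt_le_trans _ (mP i)) // padic_abs_gt0; exact: ci0.
Qed.

Section Chain.
(* [M] is the chain p L_d, L_1, ..., L_d made from a maximal simplex, and the
   vector [f i] distinguishes [M i.+1] from [M i]. *)
Context (M : nat -> set V) (M_sub : forall k, (k <= d)%N -> is_submodule (M k)).
Context (M_proper : forall k, (k < d)%N -> M k `<` M k.+1).
Context (M0 : M 0 = scale_set p%:R (M d)) (f : 'I_d -> V).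
Context (f_mem : forall i : 'I_d, M i.+1 (f i)).
Context (f_notin : forall i : 'I_d, ~ M i (f i)).

Lemma chain_mono i j : (i <= j <= d)%N -> M i `<=` M j.
Proof.
move=> /andP[ij jd]; elim: j ij jd => [|j IHj].
  by rewrite leqn0 => /eqP-> _; exact: subset_refl.
rewrite leq_eqVlt => /predU1P[-> _|ij jd]; first exact: subset_refl.
rewrite ltnS in ij.
by apply: subset_trans (IHj ij (ltnW jd)) _; case: (M_proper jd).
Qed.

Lemma chain_small j k x v : (j <= d)%N -> (k <= d)%N -> padic_abs x < 1 ->
  M j v -> M k (x *: v).
Proof.
move=> jd kd x1 Mv; apply: (@chain_mono 0) => //; rewrite M0.
apply: scale_p_mem x1 _; first exact: M_sub.
by apply: chain_mono Mv; rewrite jd leqnn.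
Qed.

(** Modulo [M k] only the [k]-th term survives: the earlier vectors lie in
    [M k], and the later ones have coefficients divisible by p, so that their
    terms lie in p [M d], which is the bottom [M 0] of the chain. *)
Lemma dominant_notin (c : 'I_d -> Qp) (k : 'I_d) :
  c k = 1 -> (forall l, padic_abs (c l) <= 1) ->
  (forall l : 'I_d, (k < l)%N -> padic_abs (c l) < 1) ->
  ~ M k (\sum_i c i *: f i).
Proof.
move=> ck c_le1 c_lt1; rewrite (bigD1 k) //= ck scale1r.
move=> /submoduleB => /(_ (M_sub (ltnW (ltn_ord k)))) Mk.
apply: (f_notin (i := k)); apply: Mk.
apply: submodule_sum => [|i ik]; first exact/M_sub/ltnW.
have [lt_ik|lt_ki|/val_inj ik'] := ltngtP i k.
- apply: submoduleZ => //; first exact/M_sub/ltnW.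
  by apply: chain_mono (f_mem i); rewrite lt_ik ltnW.
- by apply: chain_small (c_lt1 _ lt_ki) (f_mem i) => //; exact: ltnW.
- by rewrite ik' eqxx in ik.
Qed.

(** Divide the sum by its last dominant coefficient, the [k]-th; by
    [dominant_notin] the quotient is not in [M k]. If that coefficient had
    absolute value above 1, the quotient would lie in [M 0]; if it had absolute
    value 1 and [j <= k], the quotient would lie in [M j]. Both are contained in
    [M k]. *)
Lemma chain_coordinates (c : 'I_d -> Qp) j : (j <= d)%N ->
  M j (\sum_i c i *: f i) <->
  forall i, padic_abs (c i) <= padic_abs (flag_scale p_pr j i).
Proof.
move=> jd; split=> [Mj i|cs]; last first.
  apply: submodule_sum => [|i _]; first exact: M_sub.
  move: (cs i); rewrite /flag_scale; case: ltnP => [ij|ji].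
    rewrite padic_abs1 => ci; apply: submoduleZ => //; first exact: M_sub.
    by apply: chain_mono (f_mem i); rewrite ij.
  move=> ci; apply: chain_small (f_mem i) => //.
  by rewrite (le_lt_trans ci) // padic_abs_p_lt1.
have [ci0|ci0] := eqVneq (c i) 0; first by rewrite ci0 padic_abs0 padic_abs_ge0.
have [k [ck0 c_le c_lt]] := last_dominant_coordinate ci0.
have ck_gt0 : 0 < padic_abs (c k) by rewrite padic_abs_gt0; exact: ck0.
have nM : ~ M k ((c k)^-1 *: \sum_i c i *: f i).
  rewrite scaler_sumr; under eq_bigr do rewrite scalerA.
  apply: dominant_notin => [|l|l kl]; first exact: (mulVf ck0).
    by rewrite padic_absM padic_absV mulrC ler_pdivrMr // mul1r.
  by rewrite padic_absM padic_absV mulrC ltr_pdivrMr // mul1r c_lt.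
have ck_le1 : padic_abs (c k) <= 1.
  rewrite leNgt; apply/negP => ck1; apply: nM.
  apply: chain_small Mj; rewrite // ?(ltnW (ltn_ord k)) //.
  by rewrite padic_absV invf_lt1.
have [ck1|ck1] := ltP (padic_abs (c k)) 1.
  apply: le_trans (c_le i) _; apply: le_trans (padic_abs_p_le_flag _ _ _).
  by rewrite -[p%:R]mulr1; apply: padic_abs_lt; rewrite padic_abs1.
have {ck1} ck1 : padic_abs (c k) = 1 by apply/le_anti; rewrite ck_le1.
have kj : (k < j)%N.
  rewrite ltnNge; apply/negP => jk; apply: nM.
  apply: submoduleZ; [exact/M_sub/ltnW | by rewrite padic_absV ck1 invr1|].
  by apply: chain_mono Mj; rewrite jk ltnW.
rewrite /flag_scale; case: ltnP => [_|ji]; first by rewrite padic_abs1 -ck1.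
rewrite -[p%:R]mulr1; apply: padic_abs_lt; rewrite padic_abs1 -ck1.
exact: c_lt (leq_trans kj ji).
Qed.

Lemma chain_basis : exists A,
  A \in unitmx /\ forall i, A *m f i = delta_mx i 0.
Proof.
pose F : 'M[Qp]_d := \matrix_(i, k) f k i 0.
have FE (c : V) : F *m c = \sum_i c i 0 *: f i.
  apply/colP => k; rewrite mxE summxE; apply: eq_bigr => i _.
  by rewrite !mxE mulrC.
have Fu : F \in unitmx.
  rewrite -unitmx_tr -row_free_unit -kermx_eq0; apply/rowV0P => u.
  move=> /sub_kermxP/(congr1 trmx); rewrite trmx_mul trmxK trmx0 FE => cf.
  apply/rowP => i; rewrite [RHS]mxE; apply/eqP/negPn/negP => ui0.
  (* Rescaling a vanishing combination makes its [i]-th coefficient 1, while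
     zero belongs to the bottom of the chain. *)
  have M0c : M 0 (\sum_k ((u 0 i)^-1 * u 0 k) *: f k).
    under eq_bigr do rewrite -scalerA.
    rewrite -scaler_sumr; have := cf; under eq_bigr do rewrite mxE.
    by move=> ->; rewrite scaler0; case: (M_sub (leq0n d)).
  have := (chain_coordinates _ (leq0n d)).1 M0c i.
  rewrite (mulVf ui0) padic_abs1 /flag_scale ltn0 leNgt.
  by rewrite padic_abs_p_lt1.
exists (invmx F); split=> [|i]; first by rewrite unitmx_inv.
rewrite -[RHS](mulKmx Fu) FE (bigD1 i) //= !mxE !eqxx scale1r big1 ?addr0 //.
by move=> k ki; rewrite !mxE eqxx andbT (negPf ki) scale0r.
Qed.
End Chain.

Lemma adapted_basis M : (forall k, (k <= d)%N -> is_submodule (M k)) ->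
  (forall k, (k < d)%N -> M k `<` M k.+1) -> M 0 = scale_set p%:R (M d) ->
  exists A f, [/\ A \in unitmx, forall i, A *m f i = delta_mx i 0
    & forall j, (j <= d)%N -> M j = flag_lattice f j].
Proof.
move=> M_sub M_proper M0.
have pickf (i : 'I_d) : exists v, M i.+1 v /\ ~ M i v.
  have [_ /existsNP[v /not_implyP[Mv nMv]]] := M_proper i (ltn_ord i).
  by exists v.
have [f fP] := choice pickf.
have f_mem i := (fP i).1; have f_notin i := (fP i).2.
have [A [Au Af]] := chain_basis M_sub M_proper M0 f_mem f_notin.
have coord := chain_coordinates M_sub M_proper M0 f_mem f_notin.
exists A, f; split=> // j jd; rewrite (flag_lattice_box j Au Af).
apply/seteqP; split=> v; first by rewrite {1}(basis_expansion v Au Af) coord.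
by move=> bv; rewrite (basis_expansion v Au Af) coord.
Qed.

End AdaptedBasis.

(** * Balls of the norms *)

Section NormBalls.
Context (R : realType) (p : nat) (p_pr : prime p) (d : nat).
Local Notation Qp := (padic p_pr).
Local Notation V := 'cV[Qp]_d.
Implicit Types (A : 'M[Qp]_d) (q : 'I_d -> R) (c x y : Qp) (r : R) (N : V -> R).
Local Notation "`| x |p" := (ratr (padic_abs x) : R) (at level 0, x at level 99).

Let p_gt1 : 1 < p%:R :> R. Proof. by rewrite ltr1n prime_gt1. Qed.
Let p_gt0 : 0 < p%:R :> R. Proof. exact: lt_trans p_gt1. Qed.

Lemma ratr_padic_abs_gt0 c : c != 0 -> 0 < `|c|p.
Proof. by move=> c0; rewrite ltr0q padic_abs_gt0; exact: c0. Qed.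

Lemma ratr_padic_absM x y : `|x * y|p = `|x|p * `|y|p.
Proof. by rewrite padic_absM rmorphM. Qed.

Lemma ratr_padic_absV x : `|x^-1|p = `|x|p^-1.
Proof. by rewrite padic_absV fmorphV. Qed.

Lemma ratr_padic_absMp x : `|p%:R * x|p = p%:R^-1 * `|x|p.
Proof. by rewrite ratr_padic_absM padic_abs_p fmorphV /= ratr_nat. Qed.

Lemma padic_abs_approx r : 0 < r ->
  exists2 c : Qp, c != 0 & `|c|p <= r < p%:R * `|c|p.
Proof.
move=> r0.
have big (s : R) : exists n, s < p%:R ^+ n.
  exists (Num.truncn s).+1.
  rewrite (lt_trans (truncnS_gt s)) // -natrX ltr_nat.
  exact: ltn_expl (prime_gt1 p_pr).
(* Dividing by [p ^ k], which exceeds [1 / r], lets natural exponents describe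
   the least power of p above [r]. *)
have [k] := big r^-1; rewrite invf_plt ?posrE ?exprn_gt0 // => kr.
have : exists n, r < p%:R ^+ n / p%:R ^+ k.
  have [n nr] := big (r * p%:R ^+ k); exists n.
  by rewrite ltr_pdivlMr // exprn_gt0.
move=> /ex_minnP[[|n]]; first by rewrite mul1r => /(lt_trans kr); rewrite ltxx.
move=> rn nmin; have nr : p%:R ^+ n / p%:R ^+ k <= r.
  by rewrite leNgt; apply/negP => /nmin; rewrite ltnn.
have pX m : `|p%:R ^+ m : Qp|p = p%:R ^- m.
  by rewrite padic_abs_pX fmorphV rmorphXn /= ratr_nat.
exists ((p%:R ^+ k : Qp) / (p%:R ^+ n : Qp)).
  apply: (padic_mulf_neq0 (padic_pX_neq0 _ _)); rewrite invr_eq0.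
  exact: padic_pX_neq0.
rewrite ratr_padic_absM ratr_padic_absV !pX invrK mulrC nr /=.
by rewrite mulrA -exprS.
Qed.

Lemma max_norm_leP A q v r : 0 <= r ->
  matrix_max_norm A q v <= r <-> forall i, q i * `|(A *m v) i 0|p <= r.
Proof.
move=> r0; split=> [/bigmax_leP[_ vr] i|vr]; first exact: vr.
by apply/bigmax_leP; split.
Qed.

Definition central_ball N r : set V := [set v | N v <= r].

Section Chamber.
Context (A : 'M[Qp]_d) (q : 'I_d -> R) (Au : A \in unitmx).
Context (qw : chamber_weights p q).
Local Notation N := (matrix_max_norm A q).

Let q_gt0 i : 0 < q i.
Proof. by have /andP[q1 _] := qw.1 i; apply: lt_trans q1; rewrite invr_gt0. Qed.

Let q_mono (i j : 'I_d) : (i <= j)%N -> q i <= q j.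
Proof.
by rewrite leq_eqVlt => /predU1P[/val_inj->//|/qw.2 /ltW].
Qed.

(** The quotient of two weights is less than p, the smallest ratio of distinct
    nonzero absolute values. *)
Lemma weight_lt i j x c :
  padic_abs x < padic_abs c -> q i * `|x|p < q j * `|c|p.
Proof.
move=> xc; have c_gt0 : 0 < `|c|p.
  by rewrite ltr0q (le_lt_trans _ xc) ?padic_abs_ge0.
move: xc => /padic_abs_lt; rewrite -(ler_rat R) ratr_padic_absMp => xc.
have /andP[_ qi1] := qw.1 i; have /andP[qj _] := qw.1 j.
apply: (@le_lt_trans _ _ (1 * `|x|p)).
  by apply: ler_wpM2r => //; rewrite ler0q padic_abs_ge0.
by rewrite mul1r (le_lt_trans xc) // ltr_pM2r.
Qed.

(** For i <= j the weights do not affect the comparison of |x| with |c|. For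
    i > j they exclude |x| = |c|, because then q_j < q_i, and nothing smaller;
    by discreteness the bound becomes |p c|. *)
Lemma central_ball_box (j : 'I_d) c : c != 0 ->
  central_ball N (q j * `|c|p) = box A (fun i => c * flag_scale p_pr j.+1 i).
Proof.
move=> c0; have c_gt0 := ratr_padic_abs_gt0 c0.
have r0 : 0 <= q j * `|c|p by rewrite mulr_ge0 // ltW.
have key i x : (q i * `|x|p <= q j * `|c|p) =
    (padic_abs x <= padic_abs (c * flag_scale p_pr j.+1 i)).
  rewrite /flag_scale ltnS; case: leqP => [ij|ji].
    rewrite mulr1; have [xc|cx] := leP (padic_abs x) (padic_abs c).
      rewrite ler_pM ?q_mono ?(ltW (q_gt0 _)) ?ler_rat ?ler0q ?padic_abs_ge0 //.
    apply/negbTE; rewrite -ltNge; exact: weight_lt.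
  rewrite [c * _]mulrC.
  have [xpc|pcx] := leP (padic_abs x) (padic_abs (p%:R * c)).
    apply: ltW; apply: weight_lt; rewrite (le_lt_trans xpc) // padic_absM.
    by rewrite gtr_pMl ?padic_abs_p_lt1 // padic_abs_gt0; exact: c0.
  apply/negbTE; rewrite -ltNge.
  have cx : padic_abs c <= padic_abs x.
    have := padic_abs_lt pcx; rewrite !padic_absM ler_pM2l // padic_abs_gt0.
    exact: padic_p_neq0.
  apply: (@lt_le_trans _ _ (q i * `|c|p)); first by rewrite ltr_pM2r // qw.2.
  by rewrite ler_pM2l // ler_rat.
apply/seteqP; split=> v.
  by move=> /(max_norm_leP _ _ _ r0) vr i; rewrite -key.
by move=> bv; apply/(max_norm_leP _ _ _ r0) => i; rewrite key.
Qed.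

(** Choose |c| with q_0 |c| <= r < p q_0 |c|, and then the last [j] with
    q_j |c| <= r: the norm takes no value above q_j |c| and at most r. *)
Lemma central_ball_normal_form r : (0 < d)%N -> 0 < r -> exists (j : 'I_d) c,
  c != 0 /\ central_ball N r = central_ball N (q j * `|c|p).
Proof.
move=> d_gt0 r0; pose i0 := Ordinal d_gt0.
have [|c c0 /andP[cr rc]] := @padic_abs_approx (r / q i0).
  exact: divr_gt0.
have c_gt0 := ratr_padic_abs_gt0 c0.
pose P := [pred i | q i * `|c|p <= r].
have Pi0 : P i0 by rewrite /= mulrC -ler_pdivlMr.
have [j Pj jmax] := arg_maxnP val Pi0.
exists j, c; split; first exact: c0.
have qc0 : 0 <= q j * `|c|p by rewrite mulr_ge0 // ltW.
apply/seteqP; split=> v; last by move/le_trans; apply.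
move=> /(max_norm_leP _ _ _ (ltW r0)) vr; apply/(max_norm_leP _ _ _ qc0) => i.
have := vr i; move: ((A *m v) i 0) => x xr.
have [xc|cx|xc] := ltgtP (padic_abs x) (padic_abs c).
- by apply/ltW; exact: weight_lt.
- have := padic_abs_lt cx; rewrite -(ler_rat R) ratr_padic_absMp ler_pdivlMl //.
  move=> pcx; move: rc; rewrite ltr_pdivrMr // ltNge => /negP; case.
  rewrite mulrC (le_trans _ xr) // ler_pM ?(ltW (q_gt0 _)) ?q_mono //.
  by rewrite mulr_ge0 // ltW.
- by rewrite xc ler_pM2r //; apply/q_mono/jmax; rewrite /= -xc.
Qed.

Lemma central_ball_lattice r :
  (0 < d)%N -> 0 < r -> is_lattice (central_ball N r).
Proof.
move=> d_gt0 r0; have [j [c [c0 ->]]] := central_ball_normal_form d_gt0 r0.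
rewrite central_ball_box //; apply: box_lattice Au _ => i.
exact: (padic_mulf_neq0 c0 (flag_scale_neq0 _ _ _)).
Qed.

Lemma scale_central_ball c r : c != 0 -> 0 < r ->
  scale_set c (central_ball N r) = central_ball N (`|c|p * r).
Proof.
move=> c0 r0; have c_gt0 := ratr_padic_abs_gt0 c0.
have cr0 : 0 <= `|c|p * r by rewrite mulr_ge0 ?ltW.
have sub b s : b != 0 -> 0 < s ->
    scale_set b (central_ball N s) `<=` central_ball N (`|b|p * s).
  move=> b0 s0 _ [v vs <-]; have b_gt0 := ratr_padic_abs_gt0 b0.
  apply/max_norm_leP => [|i]; first by rewrite mulr_ge0 ?ltW.
  move/(max_norm_leP _ _ _ (ltW s0))/(_ i): vs.
  have -> : (A *m (b *: v)) i 0 = b * (A *m v) i 0 by rewrite -scalemxAr mxE.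
  by move=> vs; rewrite ratr_padic_absM mulrCA ler_pM2l.
apply/seteqP; split; first exact: sub.
move=> v vr; exists (c^-1 *: v); last by rewrite scalerA (divff c0) scale1r.
have ci0 : c^-1 != 0 by rewrite invr_eq0; exact: c0.
have := sub c^-1 (`|c|p * r) ci0.
rewrite mulr_gt0 // ratr_padic_absV mulKf ?gt_eqF // => /(_ isT); apply.
by exists v.
Qed.

Definition ball_classes N' : set (set (set V)) :=
  [set lattice_class (central_ball N' r) | r in [set r | 0 < r]].

Lemma ball_classes_flag (f : 'I_d -> V) : (0 < d)%N ->
  (forall i, A *m f i = delta_mx i 0) -> ball_classes N = flag_simplex f.
Proof.
move=> d_gt0 Af; have fE j := flag_lattice_box j Au Af.
have one0 : (1 : Qp) != 0 := oner_neq0 _.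
apply/seteqP; split=> [_ [r r0 <-]|_ [[|j] //= jd <-]].
  have [j [c [c0 ->]]] := central_ball_normal_form d_gt0 r0.
  exists j.+1; first by rewrite /= ltn_ord.
  by rewrite central_ball_box // -scale_box // -fE lattice_class_scale.
exists (q (Ordinal jd) * `|1 : Qp|p).
  by rewrite /= mulr_gt0 // padic_abs1 rmorph1.
rewrite (central_ball_box (Ordinal jd) one0) fE.
congr (lattice_class (box A _)).
by apply/funext => i; rewrite mul1r.
Qed.

(** A ball is a coset of a lattice, and the coset containing 0 is the lattice
    itself. *)
Lemma norm_balls_at0 B : (0 < d)%N ->
  norm_balls N B /\ B 0 <-> exists2 r, 0 < r & B = central_ball N r.
Proof.
move=> d_gt0; split=> [[[x [r r0 ->]]]|[r r0 ->]]; last first.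
  split; last by have [[]] := central_ball_lattice d_gt0 r0.
  exists 0, r => //; apply/seteqP; split=> v; rewrite /central_ball /= subr0 //.
rewrite /= sub0r => xr; exists r => //.
have [L_sub _ _] := central_ball_lattice d_gt0 r0.
apply/seteqP; split=> v vr; first exact: (submoduleB L_sub vr xr).
by case: L_sub => _ LD _; apply: LD.
Qed.

End Chamber.

(** A ball of [N1] about 0 belongs to its own class, so it is a multiple of a
    ball of [N2] about 0, hence itself such a ball; then translate. *)
Lemma norm_balls_sub N1 N2 : (0 < d)%N ->
  chamber_norms R p_pr d N1 -> chamber_norms R p_pr d N2 ->
  ball_classes N1 `<=` ball_classes N2 -> norm_balls N1 `<=` norm_balls N2.
Proof.
move=> d_gt0 [A1 [q1 [A1u q1w N1E]]] [A2 [q2 [A2u q2w N2E]]] sub.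
move=> _ [x [r r0 ->]].
have : lattice_class (central_ball N1 r) (central_ball N1 r).
  apply: lattice_class_refl; rewrite N1E.
  exact: (central_ball_lattice A1u q1w d_gt0 r0).
have [|s s0 <-] := sub (lattice_class (central_ball N1 r)); first by exists r.
move=> [_ [c c0 cE]]; exists x, (`|c|p * s).
  by rewrite mulr_gt0 // ratr_padic_abs_gt0.
have {}cE : central_ball N1 r = central_ball N2 (`|c|p * s).
  by rewrite cE N2E (scale_central_ball _ _ c0 s0).
by apply/seteqP; split=> y; have := congr1 (@^~ (y - x)) cE;
  rewrite /central_ball /= => ->.
Qed.

Lemma chamber_weights_exist : exists q : 'I_d -> R, chamber_weights p q.
Proof.
(* These weights are above 1/2, hence above 1/p, and the last one is 1. *)
exists (fun i => (d + i.+1)%:R / (d + d)%:R); split=> [i|i j ij].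
  have d_gt0 : (0 < d)%N by apply: leq_ltn_trans (ltn_ord i).
  rewrite ltr_pdivlMr ?ler_pdivrMr ?ltr0n ?addn_gt0 ?d_gt0 // mul1r ler_nat.
  rewrite leq_add2l ltn_ord andbT mulrC ltr_pdivrMr // -natrM ltr_nat.
  rewrite (@leq_trans ((d + i.+1) * 2)) //; last first.
    by rewrite leq_mul2l prime_gt1 ?orbT.
  by rewrite muln2 -addnn -addnS leq_add ?leq_addr // addnS ltnS leq_addr.
have d_gt0 : (0 < d)%N by apply: leq_ltn_trans (ltn_ord i).
by rewrite ltr_pM2r ?invr_gt0 ?ltr0n ?addn_gt0 ?d_gt0 // ltr_nat ltn_add2l.
Qed.

End NormBalls.

(** * The correspondence *)

Theorem mainTheorem2 (R : realType) (p : nat) (p_pr : prime p) (d : nat)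
    (d_gt0 : (0 < d)%N) :
  exists Phi : set ('cV[padic p_pr]_d -> R) -> set (set (set 'cV[padic p_pr]_d)),
    set_bij (chamber_norm_classes R p_pr d) (maximal_simplices p_pr d) Phi /\
    forall (A : 'M[padic p_pr]_d) (q : 'I_d -> R)
           (f : 'I_d -> 'cV[padic p_pr]_d),
      A \in unitmx -> chamber_weights p q ->
      (forall i, A *m f i = delta_mx i 0) ->
      Phi (norm_class (matrix_max_norm A q)) = flag_simplex f.
Proof.
(* Phi is defined through the balls that the norms of a class have in common,
   so no choice of a representative is involved. *)
pose Phi (C : set ('cV[padic p_pr]_d -> R)) :=
  [set lattice_class B | B in [set B | B 0 /\ exists2 N, C N & norm_balls N B]].
have PhiE N : chamber_norms R p_pr d N -> Phi (norm_class N) = ball_classes N.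
  move=> chN; have [A [q [Au qw NE]]] := chN.
  have at0 B := norm_balls_at0 Au qw B d_gt0; rewrite -NE in at0.
  apply/seteqP; split=> [_ [B [B0 [N' [_ NN'] N'B]] <-]|_ [r r0 <-]].
    have [r r0 ->] : exists2 r, 0 < r & B = central_ball N r.
      by apply/at0; rewrite NN'.
    by exists r.
  have /at0[NB B0] : exists2 s, 0 < s & central_ball N r = central_ball N s.
    by exists r.
  by exists (central_ball N r) => //; split=> //; exists N.
have Phi_flag A q (f : 'I_d -> 'cV_d) : A \in unitmx -> chamber_weights p q ->
    (forall i, A *m f i = delta_mx i 0) ->
    Phi (norm_class (@matrix_max_norm R p p_pr d A q)) = flag_simplex f.
  move=> Au qw Af; rewrite PhiE; last by exists A, q.
  exact: ball_classes_flag.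
exists Phi; split; last exact: Phi_flag.
split.
- move=> _ [N [A [q [Au qw ->]]] <-].
  have Af (i : 'I_d) : A *m (invmx A *m delta_mx i 0 : 'cV_d) = delta_mx i 0.
    by rewrite mulKVmx.
  rewrite (Phi_flag A q _ Au qw Af).
  exact: (flag_simplex_maximal d_gt0 Au Af).
- move=> C1 C2; rewrite !inE => -[N1 chN1 <-] [N2 chN2 <-].
  rewrite !PhiE // => N12; suff NN : norm_balls N1 = norm_balls N2.
    apply/seteqP; split=> N [chN NN'];
    by split=> //; rewrite /norm_equiv -NN' NN.
  by apply/seteqP; split; apply: norm_balls_sub => //; rewrite N12.
- move=> S [_ [L [latL L_p L_lt L_inj ->]]].
  pose M k := if k is k'.+1 then L k' else scale_set p%:R (L d.-1).
  have MS k : (0 < k)%N -> M k = L k.-1 by case: k.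
  have [|||A [f [Au Af Mf]]] := @adapted_basis p p_pr d M.
  + case=> [|k] kd; last by have [] := latL k kd.
    by apply: scale_submodule; have [|] := latL d.-1; rewrite ?prednK.
  + by case=> [|k] kd //; exact: L_lt.
  + by rewrite (MS d).
  have [q qw] := chamber_weights_exist R p_pr d.
  exists (norm_class (matrix_max_norm A q)).
    by exists (matrix_max_norm A q) => //; exists A, q.
  rewrite (Phi_flag A q f) //; apply/seteqP; split=> _ [j /= jd <-].
    by case: j jd => // j jd; exists j => //=; rewrite -Mf.
  by exists j.+1 => //; rewrite -Mf.
Qed.
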